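(* Let $X$ be a completely regular Hausdorff space that is an almost $P$-space. Then $X$ is Lindelöf if and only if every countable strongly annihilated proper ideal of $C(X)$ is fixed.
   Context: $C(X)$ is the ring of all continuous real-valued functions on $X$, and $Z(f)=\{x\in X: f(x)=0\}$ for $f\in C(X)$. The space $X$ is an almost $P$-space if for every $f\in C(X)$, $Z(f)\neq\emptyset$ implies $\mathrm{int}\,Z(f)\neq\emptyset$. An ideal $I$ of a commutative ring $R$ with unity is called countable strongly annihilated if for each countable subset $\{a_1,a_2,\ldots\}$ of $I$ and each $b\in R\setminus I$ there exists $c\in R$ such that $ca_n=0$ for all $n$ but $cb\neq 0$. An ideal $I$ of $C(X)$ is fixed if $\bigcap_{f\in I}Z(f)\neq\emptyset$. *)

(* Defs.v *)
From HB Require Import structures.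
From mathcomp Require Import all_boot all_order all_algebra.
From mathcomp Require Import all_classical all_reals all_analysis.
Set Implicit Arguments.
Unset Strict Implicit.
Unset Printing Implicit Defensive.
Import Order.TTheory GRing.Theory Num.Theory numFieldNormedType.Exports.
Local Open Scope classical_set_scope.
Local Open Scope ring_scope.

(** The ring C(X), carried by the type of bundled continuous functions, with
    pointwise operations. It is only a [comPzRingType]: C(X) is the zero ring
    when X is empty. *)
Section ContinuousRing.
Context {X : topologicalType} {R : realType}.
Implicit Types f g : continuousType X R.

Local Lemma continuous_addf f g : continuous (fun x => f x + g x).
Proof. by move=> x; apply: cvgD; exact: cts_fun. Qed.

Local Lemma continuous_oppf f : continuous (fun x => - f x).
Proof. by move=> x; apply: cvgN; exact: cts_fun. Qed.

Local Lemma continuous_mulf f g : continuous (fun x => f x * g x).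
Proof. by move=> x; apply: cvgM; exact: cts_fun. Qed.

Definition cts_zero : continuousType X R := cst 0.
Definition cts_one : continuousType X R := cst 1.
Definition cts_add f g : continuousType X R := mkcts (@continuous_addf f g).
Definition cts_opp f : continuousType X R := mkcts (@continuous_oppf f).
Definition cts_mul f g : continuousType X R := mkcts (@continuous_mulf f g).

Local Lemma cts_addA : associative cts_add.
Proof. by move=> f g h; apply/continuousEP => x; exact: addrA. Qed.

Local Lemma cts_addC : commutative cts_add.
Proof. by move=> f g; apply/continuousEP => x; exact: addrC. Qed.

Local Lemma cts_add0 : left_id cts_zero cts_add.
Proof. by move=> f; apply/continuousEP => x; exact: add0r. Qed.

Local Lemma cts_addN : left_inverse cts_zero cts_opp cts_add.
Proof. by move=> f; apply/continuousEP => x; exact: addNr. Qed.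

HB.instance Definition _ := GRing.isZmodule.Build (continuousType X R)
  cts_addA cts_addC cts_add0 cts_addN.

Local Lemma cts_mulA : associative cts_mul.
Proof. by move=> f g h; apply/continuousEP => x; exact: mulrA. Qed.

Local Lemma cts_mulC : commutative cts_mul.
Proof. by move=> f g; apply/continuousEP => x; exact: mulrC. Qed.

Local Lemma cts_mul1 : left_id cts_one cts_mul.
Proof. by move=> f; apply/continuousEP => x; exact: mul1r. Qed.

Local Lemma cts_mulDl : left_distributive cts_mul cts_add.
Proof. by move=> f g h; apply/continuousEP => x; exact: mulrDl. Qed.

HB.instance Definition _ := GRing.Zmodule_isComPzRing.Build
  (continuousType X R) cts_mulA cts_mulC cts_mul1 cts_mulDl.

End ContinuousRing.

(** The library's [idealr] is not used: it is restricted to [nzRingType] and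
    has properness built in. *)
Definition is_ideal (A : comPzRingType) (I : set A) : Prop :=
  [/\ I 0, forall a b, I a -> I b -> I (a + b)
    & forall a b, I b -> I (a * b)].

Definition is_proper_ideal (A : comPzRingType) (I : set A) : Prop :=
  is_ideal I /\ I <> setT.

Definition countable_strongly_annihilated (A : comPzRingType) (I : set A) :
    Prop :=
  forall S : set A, countable S -> S `<=` I ->
  forall b, ~ I b -> exists c, (forall a, S a -> c * a = 0) /\ c * b <> 0.

Section Spaces.
Context {R : realType} {X : topologicalType}.

Definition zero_set (f : continuousType X R) : set X := [set x | f x = 0].

Definition fixed_ideal (I : set (continuousType X R)) : Prop :=
  \bigcap_(f in I) zero_set f !=set0.

End Spaces.

Definition almost_P_space (R : realType) (X : topologicalType) : Prop :=
  forall f : continuousType X R,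
    zero_set f !=set0 -> interior (zero_set f) !=set0.

Definition lindelof_space (X : topologicalType) : Prop :=
  forall F : set (set X), F `<=` open -> \bigcup_(U in F) U = setT ->
  exists G : set (set X),
    [/\ G `<=` F, countable G & \bigcup_(U in G) U = setT].

(* Main.v *)
Require Import Defs.
From mathcomp Require Import all_boot all_order all_algebra.
From mathcomp Require Import all_classical all_reals all_analysis.
Set Implicit Arguments.
Unset Strict Implicit.
Unset Printing Implicit Defensive.
Import numFieldNormedType.Exports.
Import Order.TTheory GRing.Theory Num.Theory.
Local Open Scope classical_set_scope.
Local Open Scope ring_scope.

(** If X is Lindelof and the zero sets of a countable strongly annihilated
    proper ideal I had empty intersection, countably many members of I would
    already have no common zero; a function annihilating all of them is then
    zero, so it cannot witness that 1 lies outside I.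

    Conversely, let F be an open cover and D the set of functions whose
    cozero set lies in a single member of F. The functions f such that, for
    some countable subset S of D, every annihilator of S annihilates f, form a
    countable strongly annihilated ideal [countable_hull D]: the witnesses of
    countably many of its members merge into one countable S. By complete
    regularity D, hence this ideal, has no common zero; as countable strongly
    annihilated proper ideals are assumed fixed, the ideal is not proper, and
    some countable S in D has no annihilator but 0. The common zeros of S form
    a single zero set ([zero_set_bigcap]), and if it were nonempty, the almost
    P property would give it an interior point, around which complete
    regularity provides a nonzero annihilator of S. So the cozero sets of S
    cover X, and countably many members of F contain them. *)

(** The bound [n.+1%:R^-1] leaves finitely many terms of the family to control
    at a given precision, which is why the supremum stays continuous. *)
Lemma continuous_sup_vanishing (R : realType) (X : topologicalType)
    (g : nat -> X -> R) :
  (forall n, continuous (g n)) ->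
  (forall n x, 0 <= g n x <= n.+1%:R^-1) ->
  continuous (fun x => sup (range (g ^~ x))).
Proof.
move=> g_cts g_bd x.
have g_ub y : has_ubound (range (g ^~ y)).
  exists 1 => _ [n _ <-]; have /andP[_ /le_trans] := g_bd n y; apply.
  by rewrite invf_le1 ?ler1n ?ltr0n.
have g_le n y : g n y <= sup (range (g ^~ y)) by apply: ub_le_sup => //; exists n.
apply/cvgrPdist_le => e e0.
have [N Ne] : exists N, N.+1%:R^-1 < e.
  have := near_infty_natSinv_lt (PosNum e0).
  by case=> N _ /(_ N) /= H; exists N; apply: H.
(* Terms from index N on are below e at every point; compare only the others. *)
have sup_close y z : (forall n, (n < N)%N -> g n y - g n z <= e) ->
    sup (range (g ^~ y)) <= sup (range (g ^~ z)) + e.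
  move=> gyz; apply: ge_sup => [|_ [n _ <-]]; first by exists (g 0%N y), 0%N.
  have [nN|Nn] := ltnP n N.
    by rewrite -lerBlDl (le_trans _ (gyz _ nN))// lerD2l lerN2.
  have /andP[_ gn] := g_bd n y; have /andP[g0 _] := g_bd n z.
  rewrite -[leLHS]add0r lerD ?(le_trans g0)//.
  rewrite (le_trans gn)// (le_trans _ (ltW Ne))//.
  by rewrite lef_pV2 ?posrE ?ltr0n ?ler_nat ?ltnS.
have : \forall y \near x, forall i : 'I_N, `|g i x - g i y| <= e.
  by apply: filter_forall => i; have /cvgrPdist_le := @g_cts i x; apply.
apply: filterS => y gxy; rewrite ler_distlC; apply/andP; split.
  rewrite lerBlDr; apply: sup_close => n nN.
  by rewrite (le_trans (ler_norm _))//; exact: (gxy (Ordinal nN)).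
apply: sup_close => n nN; rewrite (le_trans (ler_norm _))// distrC.
exact: (gxy (Ordinal nN)).
Qed.

Section ZeroSets.
Context {R : realType} {X : topologicalType}.
Implicit Types (f s : continuousType X R) (S : set (continuousType X R)).

(** For an enumeration u of a nonempty S, the common zeros are the zeros of the
    supremum over n of min(|u_n|, 1/(n+1)). *)
Lemma zero_set_bigcap S : countable S ->
  exists f, zero_set f = \bigcap_(s in S) zero_set s.
Proof.
move=> /pfcard_geP[->|[u]].
  by exists 0; rewrite bigcap_set0; apply/seteqP; split.
pose g n x := Num.min `|u n x| n.+1%:R^-1.
have g_bd n x : 0 <= g n x <= n.+1%:R^-1.
  by rewrite /g ge_min lexx orbT le_min normr_ge0 invr_ge0 ler0n.
have g_cts n : continuous (g n).
  move=> x; apply: (@continuous_min _ _ (fun y => `|u n y|)) => //.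
    apply: (@continuous_comp _ _ _ (u n) Num.norm); first exact: cts_fun.
    exact: norm_continuous.
  exact: cvg_cst.
exists (mkcts (continuous_sup_vanishing g_cts g_bd)).
have g_eq0 n x : (g n x == 0) = (u n x == 0).
  have [un0|un0] := eqVneq (u n x) 0.
    by rewrite /g un0 normr0 min_l ?eqxx ?invr_ge0.
  by apply/negbTE; rewrite gt_eqF// /g lt_min normr_gt0 un0 invr_gt0 ltr0n.
apply/seteqP; split => x /=.
  move=> fx0 s; have /[apply] := @surj _ _ _ _ u; case=> n _ <-.
  apply/eqP; rewrite -g_eq0 eq_le; have /andP[-> _] := g_bd n x.
  rewrite andbT -[leRHS]fx0; apply: ub_le_sup; last by exists n.
  exists 1 => _ [m _ <-]; have /andP[_ /le_trans] := g_bd m x; apply.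
  by rewrite invf_le1 ?ler1n ?ltr0n.
move=> ux0; rewrite /zero_set /= -[LHS]/(sup (range (g ^~ x))).
have -> : range (g ^~ x) = [set 0]; last exact: sup1.
have g0 n : g n x = 0.
  by apply/eqP; rewrite g_eq0; apply/eqP; apply: ux0; exact: funS.
by apply/seteqP; split => [_ [n _ <-]|_ ->] //=; exists 0%N.
Qed.

Lemma completely_regular_bump (U : set X) (x : X) :
  completely_regular_space X -> open U -> U x ->
  exists f, f x <> 0 /\ ~` U `<=` zero_set f.
Proof.
move=> X_creg oU Ux.
have /(@uniform_separatorP _ R)[h [h_cts _ hx hU]] :
    uniform_separator [set x] (~` U) by apply: X_creg => //; exact: open_closedC.
have h1_cts : continuous (fun y => 1 - h y).
  by move=> y; apply: cvgB; [exact: cvg_cst|exact: h_cts].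
exists (mkcts h1_cts); split => [|y Uy].
  change (1 - h x <> 0).
  have -> : h x = 0 by apply: hx; exists x.
  by rewrite subr0; apply/eqP; exact: oner_neq0.
change (1 - h y = 0).
have -> : h y = 1 by apply: hU; exists y.
by rewrite subrr.
Qed.

(** The common zeros of S form one zero set Z. In an almost P space a nonempty
    Z has an interior point, and a bump around it supported in the interior
    of Z would be a nonzero annihilator of S. *)
Lemma ann_no_common_zero S :
  completely_regular_space X -> almost_P_space R X -> countable S ->
  (forall c, (forall s, S s -> c * s = 0) -> c = 0) ->
  \bigcap_(s in S) zero_set s = set0.
Proof.
move=> X_creg X_almostP /zero_set_bigcap[f fE] S_ann.
rewrite -fE; apply: contrapT => /eqP/set0P/X_almostP[x xZ].
have [c [cx0 cZ]] := completely_regular_bump X_creg (@open_interior _ _) xZ.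
apply: cx0; rewrite (S_ann c) // => s Ss; apply/continuousEP => y /=.
have [yZ|/cZ cy0] := pselect ((zero_set f)^° y).
  have /interior_subset := yZ; rewrite fE => /(_ s Ss) sy0.
  by have -> : (c * s) y = c y * s y by []; rewrite sy0 mulr0.
by have -> : (c * s) y = c y * s y by []; rewrite cy0 mul0r.
Qed.

End ZeroSets.

Section CountableHull.
Variable A : comPzRingType.
Implicit Types D S : set A.

(** The union of the double annihilators of the countable subsets of D. *)
Definition countable_hull D : set A :=
  [set a | exists S, [/\ countable S, S `<=` D &
    forall c, (forall s, S s -> c * s = 0) -> c * a = 0]].

Lemma sub_countable_hull D : D `<=` countable_hull D.
Proof.
move=> a Da; exists [set a]; split=> [|_ ->//|c]; first exact: countable1.
exact.
Qed.

(** A single countable witness for a whole countable set of members is what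
    makes the hull both additively closed and strongly annihilated. *)
Lemma countable_hull_witness D T : countable T -> T `<=` countable_hull D ->
  exists S, [/\ countable S, S `<=` D & forall c,
    (forall s, S s -> c * s = 0) -> forall a, T a -> c * a = 0].
Proof.
move=> T_count T_hull.
have /choice[w wP] : forall a, exists S, T a -> [/\ countable S, S `<=` D &
    forall c, (forall s, S s -> c * s = 0) -> c * a = 0].
  move=> a; have [/T_hull[S SP]|//] := pselect (T a); first by exists S.
  by exists set0.
exists (\bigcup_(a in T) w a); split=> [|s [a /wP[_ + _]]|c c0 a Ta].
- by apply: bigcup_countable => // a /wP[].
- exact.
- by have [_ _] := wP a Ta; apply => s ws; apply: c0; exists a.
Qed.

Lemma is_ideal_countable_hull D : is_ideal (countable_hull D).
Proof.
split=> [|a b Da Db|a b [S [S_count SD S_ann]]].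
- by exists set0; split=> // c _; rewrite mulr0.
- have [||S [S_count SD S_ann]] := @countable_hull_witness D [set a; b].
  + by apply: finite_set_countable; exact: finite_set2.
  + by move=> _ [->|->].
  by exists S; split=> // c /S_ann c0; rewrite mulrDr !c0 ?addr0 /=; auto.
- by exists S; split=> // c /S_ann c0; rewrite mulrCA c0 mulr0.
Qed.

Lemma countable_hull_csa D : countable_strongly_annihilated (countable_hull D).
Proof.
move=> T T_count /(countable_hull_witness T_count)[S [S_count SD S_ann]] b Db.
apply: contrapT => no_c; apply: Db; exists S; split=> // c c0.
by apply: contrapT => cb0; apply: no_c; exists c; split=> //; exact: S_ann.
Qed.

End CountableHull.

Theorem proposition4p16 (R : realType) (X : topologicalType)
    (X_creg : completely_regular_space X) (X_T2 : hausdorff_space X)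
    (X_almostP : almost_P_space R X) :
  lindelof_space X <->
  (forall I : set (continuousType X R),
     is_proper_ideal I -> countable_strongly_annihilated I -> fixed_ideal I).
Proof.
split=> [X_lind I [[_ _ I_mul] I_proper] I_csa|X_fixed F F_open F_cover].
  apply: contrapT => I_free.
  have [||G [GF G_count G_cover]] := X_lind [set ~` zero_set f | f in I].
  - move=> _ [f _ <-]; apply: closed_openC.
    by apply: (closed_comp _ (@closed_eq R 0)) => x _; exact: cts_fun.
  - apply/seteqP; split=> // x _; apply: contrapT => x_zero; apply: I_free.
    exists x => f If; apply: contrapT => fx0; apply: x_zero.
    by exists (~` zero_set f) => //; exists f.
  have /choice[w wP] : forall U, exists f, G U -> I f /\ ~` zero_set f = U.
    move=> U; have [/GF[f If <-]|nU] := pselect (G U); first by exists f.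
    by exists 0.
  have I1 : ~ I 1.
    move=> I1; apply: I_proper; apply/seteqP; split=> // f _.
    by rewrite -[f]mulr1; exact: I_mul.
  have [||c [c_ann]] := I_csa (w @` G) _ _ 1 I1.
  - exact: sub_countable (card_image_le _ _) _.
  - by move=> _ [U /wP[If _] <-].
  rewrite mulr1; apply; apply/continuousEP => x.
  have : setT x by [].
  rewrite -G_cover => -[U GU Ux]; have [_ wU] := wP U GU.
  have /continuousEP/(_ x)/eqP : c * w U = 0 by apply: c_ann; exists U.
  rewrite mulf_eq0 => /orP[/eqP//|/eqP wx0].
  by move: Ux; rewrite -wU => /(_ wx0).
pose D := [set s : continuousType X R | exists2 U, F U & ~` U `<=` zero_set s].
have hullT : countable_hull D = setT.
  apply: contrapT => D_proper.
  have [|x xZ] := X_fixed (countable_hull D) _ (@countable_hull_csa _ D).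
    by split=> //; exact: is_ideal_countable_hull.
  have : setT x by [].
  rewrite -F_cover => -[U FU Ux].
  have [f [fx0 fU]] := completely_regular_bump (R := R) X_creg (F_open _ FU) Ux.
  by apply: fx0; apply: (xZ f); apply: sub_countable_hull; exists U.
have [S [S_count SD S_ann]] : countable_hull D 1 by rewrite hullT.
have S_zero : \bigcap_(s in S) zero_set s = set0.
  by apply: ann_no_common_zero => // c /S_ann; rewrite mulr1.
have /choice[w wP] : forall s, exists U, S s -> F U /\ ~` U `<=` zero_set s.
  move=> s; have [/SD[U FU Us]|nS] := pselect (S s); first by exists U.
  by exists set0.
exists (w @` S); split.
- by move=> _ [s /wP[FU _] <-].
- exact: sub_countable (card_image_le _ _) _.
- apply/seteqP; split=> // x _; apply: contrapT => x_out.
  have : (\bigcap_(s in S) zero_set s) x; last by rewrite S_zero.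
  move=> s Ss; have [_ +] := wP s Ss; apply => wx; apply: x_out.
  by exists (w s) => //; exists s.
Qed.
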